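(* For each positive integer $N$, let $B_N=[b_{ij,N}]_{i,j=1}^N$ be a self-adjoint matrix in $M_N(\mathcal{A})$ such that the family $\{b_{ij,N}: 1\le i\le j\le N\}$ is Boolean independent and (1) the variables $\{b_{ij,N}:1\le i<j\le N\}$ are identically distributed and such that, for $i<j$, (1.1) $\displaystyle\lim_{N\to\infty}N^{\varepsilon}\varphi\big(b_{ij,N}^{\xi_1}b_{ij,N}^{\xi_2}\cdots b_{ij,N}^{\xi_n}\big)=0$ for any $\varepsilon<1$, any $n\ge1$ and any $\xi_1,\dots,\xi_n\in\{1,*\}$; (1.2) $\displaystyle\lim_{N\to\infty}N\varphi\big((b_{ij,N}b_{ij,N}^* )^m\big)=\lim_{N\to\infty}N\varphi\big((b_{ij,N}^*b_{ij,N})^m\big)=0$ for all $m>1$; (1.3) $\displaystyle\lim_{N\to\infty}N\varphi\big(b_{ij,N}b_{ij,N}^*\big)=\alpha$ and $\displaystyle\lim_{N\to\infty}N\varphi\big(b_{ij,N}^*b_{ij,N}\big)=\beta$ for some $\alpha,\beta>0$; (2) the variables $\{b_{ii,N}:i\in[N]\}$ are self-adjoint, identically distributed and such that for any positive integer $n$ and any $i\in[N]$, $\displaystyle\lim_{N\to\infty}\varphi\big(b_{ii,N}^n\big)=0$. Then the asymptotic distribution of $B_N$ exists (i.e. $\lim_{N\to\infty}\varphi\circ\mathrm{tr}(B_N^n)$ exists for every positive integer $n$) and all its odd moments vanish asymptotically (i.e. $\lim_{N\to\infty}\varphi\circ\mathrm{tr}(B_N^n)=0$ for every odd $n$). Moreover,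 $B_N$ is asymptotically Bernoulli distributed if and only if $\alpha=\beta$.
   Context: $[N]=\{1,\dots,N\}$. A non-commutative probability space is a pair $(\mathcal{A},\varphi)$ with $\mathcal{A}$ a complex unital algebra and $\varphi:\mathcal{A}\to\mathbb{C}$ a unital $\mathbb{C}$-linear map; here $\mathcal{A}$ is moreover a $*$-algebra, and no positivity of $\varphi$ is required. $x^1=x$ and $x^*$ is the adjoint. Boolean independence: a family of (not necessarily unital) subalgebras $\{\mathcal{A}_j\}_j$ of $\mathcal{A}$ is Boolean independent with respect to $\varphi$ if $\varphi(a_1a_2\cdots a_m)=\varphi(a_1)\varphi(a_2)\cdots\varphi(a_m)$ for all $m\ge1$ whenever $a_k\in\mathcal{A}_{i(k)}$ and consecutive indices $i(k),i(k+1)$ are distinct. A family of variables is Boolean independent if the non-unital $*$-subalgebras they generate are Boolean independent. Variables $x,y$ are identically distributed if $\varphi(x^{\xi_1}\cdots x^{\xi_n})=\varphi(y^{\xi_1}\cdots y^{\xi_n})$ for all $n\geq 1$ and $\xi\in\{1,*\}^n$; in the claim this is for each fixed $N$. Random matrices: $M_N(\mathcal{A})$ is the algebra of $N\times N$ matrices over $\mathcal{A}$, with adjoint $(A^* )_{ij}=(a_{ji})^*$ and functional $\varphi\circ\mathrm{tr}(A)=\frac1N\sum_{i=1}^N\varphi(a_{ii})$. So $B_N$ self-adjoint means $b_{ji,N}=b_{ij,N}^*$. Bernoulli distribution: a self-adjoint variable $X$ is Bernoulli distributed of mean $0$ and variance $\gamma>0$ if $\varphi(X^n)=0$ for $n$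 odd and $\varphi(X^n)=\gamma^{n/2}$ for $n$ even. $B_N$ is asymptotically Bernoulli distributed if there is $\gamma>0$ such that $\lim_{N\to\infty}\varphi\circ\mathrm{tr}(B_N^n)$ equals $0$ for all odd $n$ and $\gamma^{n/2}$ for all even $n$. *)

(* Defs.v *)
From HB Require Import structures.
From mathcomp Require Import all_boot all_order all_algebra.
From mathcomp Require Import complex.
From mathcomp Require Import all_classical all_reals all_analysis.

Set Implicit Arguments.
Unset Strict Implicit.
Unset Printing Implicit Defensive.

Import Order.TTheory GRing.Theory Num.Theory.
Import numFieldNormedType.Exports.

Local Open Scope classical_set_scope.
Local Open Scope complex_scope.
Local Open Scope ring_scope.

Section StarProbabilitySpace.
Variables (R : realType) (A : algType R[i]).

Record is_adjoint (star : A -> A) : Prop := IsAdjoint {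
  adjointK : forall x, star (star x) = x;
  adjointD : forall x y, star (x + y) = star x + star y;
  adjointZ : forall (c : R[i]) x, star (c *: x) = Num.conj c *: star x;
  adjointM : forall x y, star (x * y) = star y * star x
}.

(* Subalgebras are not required to contain 1. *)
Record star_subalgebra (star : A -> A) (S : set A) : Prop := StarSubalgebra {
  star_subalgebra0 : S 0;
  star_subalgebraD : forall x y, S x -> S y -> S (x + y);
  star_subalgebraZ : forall (c : R[i]) x, S x -> S (c *: x);
  star_subalgebraM : forall x y, S x -> S y -> S (x * y);
  star_subalgebra_star : forall x, S x -> S (star x)
}.

Definition generated_star_subalgebra (star : A -> A) (x : A) : set A :=
  smallest (star_subalgebra star) [set x].

(* The family (S i) is indexed by the i in D. Only the values of i and a at
   0, ..., m - 1 matter; the product of the a k is taken in this order. *)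
Definition boolean_independent (phi : A -> R[i]) (I : Type) (D : set I)
    (S : I -> set A) : Prop :=
  forall (m : nat) (i : nat -> I) (a : nat -> A), (0 < m)%N ->
    (forall k, (k < m)%N -> D (i k) /\ S (i k) (a k)) ->
    (forall k, (k.+1 < m)%N -> i k <> i k.+1) ->
  phi (\prod_(k < m) a k) = \prod_(k < m) phi (a k).

Definition boolean_independent_variables (star : A -> A) (phi : A -> R[i])
    (I : Type) (D : set I) (x : I -> A) : Prop :=
  boolean_independent phi D (fun i => generated_star_subalgebra star (x i)).

(* An exponent sequence in {1, *}^n is a sequence of booleans of size n, with
   true standing for * and false for 1. *)
Definition star_word (star : A -> A) (x : A) (xi : seq bool) : A :=
  \prod_(s <- xi) (if s then star x else x).

Definition identically_distributed (star : A -> A) (phi : A -> R[i])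
    (x y : A) : Prop :=
  forall xi : seq bool, (0 < size xi)%N ->
    phi (star_word star x xi) = phi (star_word star y xi).

Definition mx_adjoint (star : A -> A) (N : nat) (M : 'M[A]_N) : 'M[A]_N :=
  \matrix_(i, j) star (M j i).

Definition phi_tr (phi : A -> R[i]) (N : nat) (M : 'M[A]_N) : R[i] :=
  N%:R^-1 * \sum_(i < N) phi (M i i).

(* The entry with natural number indices, needed to let N tend to infinity with
   i and j fixed; the default 0 only occurs for N <= maxn i j. *)
Definition entry (N : nat) (M : 'M[A]_N) (i j : nat) : A :=
  match insub i, insub j with
  | Some i', Some j' => M i' j'
  | _, _ => 0
  end.

(* The regular module R[i]^o carries the topology of the complex modulus. *)
Definition tends_to (u : nat -> R[i]) (l : R[i]) : Prop :=
  (u : nat -> R[i]^o) @ \oo --> (l : R[i]^o).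

Definition moment (phi : A -> R[i]) (B : forall N, 'M[A]_N) (n N : nat) :
    R[i] :=
  phi_tr phi (B N ^+ n).

Definition asymptotic_distribution_exists (phi : A -> R[i])
    (B : forall N, 'M[A]_N) : Prop :=
  forall n, (0 < n)%N -> exists l : R[i], tends_to (moment phi B n) l.

Definition asymptotically_bernoulli (phi : A -> R[i])
    (B : forall N, 'M[A]_N) : Prop :=
  exists2 gamma : R, 0 < gamma &
    forall n, tends_to (moment phi B n)
                (if odd n then 0 else (gamma ^+ n./2)%:C).

End StarProbabilitySpace.

(* Main.v *)
Require Import Defs.
From HB Require Import structures.
From mathcomp Require Import all_boot all_order all_algebra.
From mathcomp Require Import complex.
From mathcomp Require Import all_classical all_reals all_analysis.
From mathcomp Require Import ring lra.

Import Order.TTheory GRing.Theory Num.Theory.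
Import numFieldNormedType.Exports.

Local Open Scope classical_set_scope.
Local Open Scope complex_scope.
Local Open Scope ring_scope.

(* Cut a closed walk i_0, i_1, ..., i_n = i_0 into its maximal runs, each going
   back and forth along one edge {i, j}. Boolean independence factorizes the
   expectation of b_{i_0 i_1} ... b_{i_{n-1} i_n} over the runs. A run of odd
   length along i <> j moves to one of N vertices at a cost of N^(-1 + o(1));
   since the walk has to come back, such runs are negligible. So are the loops
   and the even runs of length at least 4, and what is left are runs of length
   2, with expectation about alpha / N if i < j and beta / N if j < i. Summing
   over j, each of them contributes alpha + (beta - alpha) i / N in the limit.
   Hence the odd moments vanish, and the moment of order 2 m tends to the
   integral over [0, 1] of (alpha + (beta - alpha) t) ^ m, which is gamma ^ m for
   m = 1, 2 only if alpha = beta. *)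

Set Implicit Arguments.
Unset Strict Implicit.

(** * Factorization of expectations of alternating products *)

Section BooleanProducts.
Variables (R : realType) (A : algType R[i]) (phi : {scalar A}).
Variables (I : Type) (D : set I) (S : I -> set A).

(** [q] is the index forbidden to the first factor, [None] forbidding nothing. The unit, as empty
    product, is put in by hand since the [S p] need not contain it. *)
Inductive alternating_span : option I -> A -> Prop :=
| alternating1 q : alternating_span q 1
| alternatingD q x y : alternating_span q x -> alternating_span q y ->
    alternating_span q (x + y)
| alternating0 q : alternating_span q 0
| alternatingM q p a x : D p -> S p a -> Some p <> q ->
    alternating_span (Some p) x -> alternating_span q (a * x).

Hypothesis (phi1 : phi 1 = 1) (indep : boolean_independent phi D S).

(** Boolean independence speaks of complete alternating products only, so a prefix is carried along:
    it absorbs the factors of [x] one at a time until the unit is left. *)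
Lemma phi_alternating_prefix q x : alternating_span q x ->
  forall m (i : nat -> I) (a : nat -> A), (0 < m)%N -> Some (i m.-1) = q ->
    (forall k, (k < m)%N -> D (i k) /\ S (i k) (a k)) ->
    (forall k, (k.+1 < m)%N -> i k <> i k.+1) ->
  phi ((\prod_(k < m) a k) * x) = (\prod_(k < m) phi (a k)) * phi x.
Proof.
elim=> {q x} [q|q x y _ IHx _ IHy|q|q p b x Dp Sb npq _ IH] m i a m0 iq aS ai.
- by rewrite mulr1 phi1 mulr1 (indep m0 aS ai).
- by rewrite mulrDr !linearD /= (IHx m i a) // (IHy m i a) // mulrDr.
- by rewrite mulr0 linear0 mulr0.
(* The prefix extended by [b] in position [m]; it still alternates because [p] differs from the last
   index [i m.-1]. *)
pose i' k := if (k < m)%N then i k else p.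
pose a' k := if (k < m)%N then a k else b.
have := IH m.+1 i' a' isT; rewrite /i' /a' /= ltnn !big_ord_recr /= ltnn.
have -> : \prod_(k < m) (if (k < m)%N then a k else b) = \prod_(k < m) a k.
  by apply: eq_bigr => k _; rewrite ltn_ord.
have -> : \prod_(k < m) phi (if (k < m)%N then a k else b)
        = \prod_(k < m) phi (a k).
  by apply: eq_bigr => k _; rewrite ltn_ord.
rewrite mulrA => -> //; last first.
- move=> k; rewrite ltnS => km; rewrite km.
  case: ifP => km'; first exact: ai.
  move=> ikp; apply: npq; rewrite -iq -ikp; congr (Some (i _)).
  by apply/eqP; rewrite -eqSS (prednK m0) eqn_leq km leqNgt km'.
- by move=> k km; case: ifP => // km'; apply: aS.
(* The same induction hypothesis, with [b] alone as prefix, splits [phi (b * x)]. *)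
have := IH 1%N (fun=> p) (fun=> b) isT erefl.
rewrite !big_ord1 /= => -> //; first by rewrite mulrA.
Qed.

Lemma phi_alternatingM p a x : D p -> S p a -> alternating_span (Some p) x ->
  phi (a * x) = phi a * phi x.
Proof.
move=> Dp Sa /phi_alternating_prefix /(_ 1%N (fun=> p) (fun=> a) isT erefl).
by rewrite !big_ord1; apply.
Qed.

End BooleanProducts.

(** * Matrix powers as sums over walks cut into runs *)

Section Walks.
Variables (A : nzRingType) (N : nat) (M : 'M[A]_N).
Implicit Types (i j k : 'I_N) (p : option ('I_N * 'I_N)).

(** The independent variables are the entries on or above the diagonal; for a self-adjoint [M] this
    is the index of the one whose algebra contains [M i j]. *)
Definition edge i j : 'I_N * 'I_N := if (i <= j)%N then (i, j) else (j, i).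

Lemma edgeC i j : edge i j = edge j i.
Proof. by rewrite /edge; case: ltngtP => // /val_inj ->. Qed.

Lemma edge_le i j : ((edge i j).1 <= (edge i j).2)%N.
Proof. by rewrite /edge; case: (leqP i j) => //= ji; exact: ltnW. Qed.

Lemma edge_inj i : injective (edge i).
Proof.
by move=> j k; rewrite /edge; case: leqP => ij; case: leqP => ik [] // ->.
Qed.

Fixpoint back_and_forth l i j : A :=
  if l is l'.+1 then M i j * back_and_forth l' j i else 1.

(* Sum over the walks of length n from i to k of the products of the entries
   of M met, the first step being not allowed to use the edge p. *)
Definition walks n i k p : A :=
  if n is n'.+1 then \sum_(j | Some (edge i j) != p) M i j * (M ^+ n') j k
  else (i == k)%:R.

Lemma exprS_mxE n i k : (M ^+ n.+1) i k = \sum_j M i j * (M ^+ n) j k.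
Proof. by rewrite exprS mxE. Qed.

Lemma expr_mx_walks n i k : (M ^+ n) i k = walks n i k None.
Proof. by case: n => [|n]; [rewrite expr0 mxE | rewrite exprS_mxE]. Qed.

(** Walks are sorted by the number [l] of initial steps along [{i, j}]. The case [l = 0] is a first
    step along another edge, and the parity of [l] gives the vertex reached. *)
Lemma expr_mx_run n i j k :
  (M ^+ n) i k = \sum_(l < n.+1) back_and_forth l i j *
    walks (n - l) (if odd l then j else i) k (Some (edge i j)).
Proof.
elim: n i j => [|n IHn] i j; first by rewrite big_ord1 mul1r /= expr0 mxE.
rewrite exprS_mxE (bigD1 j) //= big_ord_recl /= mul1r addrC; congr (_ + _).
  by apply: eq_bigl => j'; congr (~~ _); apply/eqP/eqP => [->|[/edge_inj]].
rewrite (IHn j i) mulr_sumr; apply: eq_bigr => l _.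
by rewrite mulrA edgeC if_neg.
Qed.

(** The first step goes to some [j]; [expr_mx_run], read from [j], then counts the [l] further steps
    along the same edge. *)
Lemma walksS n i k p :
  walks n.+1 i k p = \sum_(l < n.+1) \sum_(j | Some (edge i j) != p)
    back_and_forth l.+1 i j *
    walks (n - l) (if odd l.+1 then j else i) k (Some (edge i j)).
Proof.
rewrite exchange_big; apply: eq_bigr => j _ /=.
rewrite (expr_mx_run n j i) mulr_sumr; apply: eq_bigr => l _.
by rewrite mulrA edgeC if_neg.
Qed.

End Walks.

(** * Expectations of walks under Boolean independence *)

Section WalkExpectation.
Variables (R : realType) (A : algType R[i]) (star : A -> A).

Definition alternating_word b l : seq bool := traject negb b l.

Lemma generated_star_subalgebra_mem x : generated_star_subalgebra star x x.
Proof. by move=> T [_]; apply. Qed.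

Lemma generated_star_subalgebraP x :
  star_subalgebra star (generated_star_subalgebra star x).
Proof.
split=> [T|y z gy gz T|c y gy T|y z gy gz T|y gy T] gT; have [ST xT] := gT.
- exact: star_subalgebra0 ST.
- by apply: (star_subalgebraD ST); [apply: gy|apply: gz].
- by apply: (star_subalgebraZ ST); apply: gy.
- by apply: (star_subalgebraM ST); [apply: gy|apply: gz].
- by apply: (star_subalgebra_star ST); apply: gy.
Qed.

Lemma star_word_generated x xi :
  (0 < size xi)%N -> generated_star_subalgebra star x (star_word star x xi).
Proof.
have gx := @generated_star_subalgebra_mem x.
have ST := generated_star_subalgebraP x.
have gs (s : bool) : generated_star_subalgebra star x (if s then star x else x).
  by case: s => //; apply: (star_subalgebra_star ST).
rewrite /star_word; elim: xi => // s [|s' xi] IH _.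
  by rewrite big_seq1.
by rewrite big_cons; apply: (star_subalgebraM ST) => //; apply: IH.
Qed.

Lemma star_word_even x b m : star_word star x (alternating_word b m.*2) =
  (if b then star x * x else x * star x) ^+ m.
Proof.
rewrite /star_word /alternating_word; elim: m => [|m IHm].
  by rewrite big_nil expr0.
by rewrite doubleS /= !big_cons negbK IHm exprS mulrA; case: (b).
Qed.

Lemma star_word_selfadjoint x xi :
  star x = x -> star_word star x xi = x ^+ size xi.
Proof.
move=> xx; rewrite /star_word (eq_bigr (fun=> x)) => [|[] _] //.
by rewrite big_const_seq count_predT; elim: size => //= n ->; rewrite exprS.
Qed.

Variables (N : nat) (M : 'M[A]_N).
Hypothesis M_sa : mx_adjoint star M = M.

Lemma star_entry i j : star (M i j) = M j i.
Proof. by rewrite -[in RHS]M_sa mxE. Qed.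

(** Entries below the diagonal are adjoints of those above, so a run alternates one variable and its
    adjoint, starting with the adjoint when the first step decreases the index. *)
Lemma back_and_forth_offdiag l (i j : 'I_N) : i != j ->
  back_and_forth M l i j =
  star_word star (M (edge i j).1 (edge i j).2) (alternating_word (j < i)%N l).
Proof.
elim: l i j => [|l IHl] i j ij; first by rewrite /star_word big_nil.
rewrite /= IHl 1?eq_sym // /star_word big_cons -/(star_word _ _ _).
rewrite edgeC /edge star_entry.
move: ij; rewrite -val_eqE /= /star_word !star_entry.
by case: ltngtP => // _ _; rewrite /= ?star_entry.
Qed.

Lemma back_and_forth_diag l (i : 'I_N) : back_and_forth M l i i = M i i ^+ l.
Proof. by elim: l => //= l ->; rewrite exprS. Qed.

Lemma back_and_forth_generated l (i j : 'I_N) : (0 < l)%N ->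
  generated_star_subalgebra star (M (edge i j).1 (edge i j).2)
    (back_and_forth M l i j).
Proof.
move=> l0; have [<-|ij] := eqVneq i j; last first.
  by rewrite back_and_forth_offdiag //; apply: star_word_generated;
     rewrite size_traject.
rewrite back_and_forth_diag /edge leqnn /=.
rewrite -[l](size_nseq _ false) -star_word_selfadjoint ?star_entry //.
by apply: star_word_generated; rewrite size_nseq.
Qed.

Variable phi : {scalar A}.
Hypotheses (phi1 : phi 1 = 1) (indep : boolean_independent_variables star phi
  [set p : 'I_N * 'I_N | (p.1 <= p.2)%N] (fun p => M p.1 p.2)).

Let subalg (p : 'I_N * 'I_N) := generated_star_subalgebra star (M p.1 p.2).

(** Runs are maximal, so successive ones use distinct edges, and edges index the independent
    algebras. *)
Lemma walks_alternating n i k p :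
  alternating_span [set p : 'I_N * 'I_N | (p.1 <= p.2)%N] subalg p
    (walks M n i k p).
Proof.
elim/ltn_ind: n i k p => -[_|n IHn] i k p.
  by rewrite /=; case: (i == k); [exact: alternating1|exact: alternating0].
rewrite walksS.
elim/big_rec: _ => [|l x _ ax]; first exact: alternating0.
apply: alternatingD => //.
elim/big_rec: _ => [|j y jp ay]; first exact: alternating0.
apply: alternatingD => //.
apply: (@alternatingM _ _ _ _ _ _ (edge i j)) => /=.
- exact: edge_le.
- exact: (@back_and_forth_generated l.+1 i j).
- exact/eqP.
- by apply: IHn; rewrite ltnS leq_subr.
Qed.

(** This recursion replaces the algebra from here on: its only data are expectations of single
    runs. *)
Lemma phi_walksS n i k p :
  phi (walks M n.+1 i k p) = \sum_(l < n.+1) \sum_(j | Some (edge i j) != p)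
    phi (back_and_forth M l.+1 i j) *
    phi (walks M (n - l) (if odd l.+1 then j else i) k (Some (edge i j))).
Proof.
rewrite walksS linear_sum; apply: eq_bigr => l _.
rewrite linear_sum; apply: eq_bigr => j _ /=.
apply: (phi_alternatingM phi1 indep (p := edge i j)); first exact: edge_le.
  exact: (@back_and_forth_generated l.+1 i j).
exact: walks_alternating.
Qed.

End WalkExpectation.

(** * Complex moduli, limits and subpolynomial sequences *)

Section Modulus.
Variable R : realType.
Implicit Types (x y z : R[i]) (a b : nat -> R).

Definition modulus z : R := ComplexField.Normc.normc z.

Lemma normE z : `|z| = (modulus z)%:C. Proof. by []. Qed.

Lemma modulus0 : modulus 0 = 0. Proof. exact: ComplexField.Normc.normc0. Qed.

Lemma modulusM x y : modulus (x * y) = modulus x * modulus y.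
Proof. exact: ComplexField.Normc.normcM. Qed.

Lemma modulusV x : modulus x^-1 = (modulus x)^-1.
Proof. exact: ComplexField.Normc.normcV. Qed.

Lemma le_modulusD x y : modulus (x + y) <= modulus x + modulus y.
Proof. exact: le_normcD. Qed.

Lemma modulusB x y : modulus (x - y) = modulus (y - x).
Proof. by rewrite -[LHS]normcN opprB. Qed.

Lemma modulus_ge0 z : 0 <= modulus z.
Proof. by case: z => r s; exact: sqrtr_ge0. Qed.

Lemma modulus_real (r : R) : modulus r%:C = `|r|.
Proof. by rewrite /modulus /= expr0n addr0 sqrtr_sqr. Qed.

Lemma modulus_nat n : modulus n%:R = n%:R.
Proof. by rewrite -(rmorph_nat (real_complex R)) modulus_real ger0_norm. Qed.

Lemma le_modulus_sum (I : Type) (r : seq I) (P : pred I) (F : I -> R[i]) :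
  modulus (\sum_(i <- r | P i) F i) <= \sum_(i <- r | P i) modulus (F i).
Proof.
elim/big_rec2: _ => [|i s z _ le_zs]; first by rewrite modulus0.
by rewrite (le_trans (le_modulusD _ _)) // lerD2l.
Qed.

Lemma tends_toP (u : nat -> R[i]) l :
  tends_to u l <-> (fun N => modulus (u N - l)) @ \oo --> (0 : R).
Proof.
split=> [/cvgrPdist_le ul|ul].
  apply/cvgr0Pnorm_le => e e0.
  have := ul e%:C; rewrite ltcR => /(_ e0).
  apply: filterS => N; rewrite normE lecR modulusB ger0_norm //.
  exact: modulus_ge0.
(* A positive element of [R[i]] has zero imaginary part, so the tolerance is real. *)
apply/cvgrPdist_le => -[e e'] /=; rewrite ltcE /= => /andP[/eqP -> e0].
move/cvgr0Pnorm_le: ul => /(_ e e0); apply: filterS => N.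
rewrite ger0_norm ?modulus_ge0 // => h.
by rewrite normE modulusB lecE /= eqxx.
Qed.

Lemma tends_to0P (u : nat -> R[i]) :
  tends_to u 0 <-> (fun N => modulus (u N)) @ \oo --> (0 : R).
Proof.
rewrite tends_toP; under [X in _ <-> X @ _ --> _]eq_fun do rewrite -[u _]subr0.
by [].
Qed.

Lemma tends_to_modulus (u : nat -> R[i]) l :
  tends_to u l -> (fun N => modulus (u N)) @ \oo --> modulus l.
Proof.
move=> /tends_toP/cvgr0Pnorm_le ul; apply/cvgrPdist_le => e /ul.
apply: filterS => N; rewrite ger0_norm ?modulus_ge0 //; apply: le_trans.
rewrite ler_norml lerBlDr; apply/andP; split.
  by rewrite lerBrDl lerBlDr addrC -{1}[u N](subrK l) le_modulusD.
by rewrite modulusB -{1}[l](subrK (u N)) le_modulusD.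
Qed.

Lemma tends_to_real a (l : R) :
  a @ \oo --> l -> tends_to (fun N => (a N)%:C) l%:C.
Proof.
move=> al; apply/tends_toP.
under eq_fun do rewrite -rmorphB modulus_real.
by rewrite -(normr0 R) -(subrr l); apply: cvg_norm; apply: cvgB al (cvg_cst _).
Qed.

Lemma tends_to_unique (u : nat -> R[i]) l m :
  tends_to u l -> tends_to u m -> l = m.
Proof. by move=> ul um; apply: (cvg_unique _ ul um). Qed.

(** The threshold [1 < N] is the one from which the matrix has an entry of indices 0 and 1. *)
Lemma squeeze_cvg0 a b : (forall N, (1 < N)%N -> 0 <= a N <= b N) ->
  b @ \oo --> (0 : R) -> a @ \oo --> (0 : R).
Proof.
move=> ab b0.
apply: (@squeeze_cvgr _ _ _ _ (fun=> 0) b) => //; last exact: cvg_cst.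
by near=> N; apply: ab; near: N; exact: nbhs_infty_gt.
Unshelve. all: by end_near. Qed.

Lemma tends_to_squeeze (u v : nat -> R[i]) l b :
  (forall N, (1 < N)%N -> modulus (u N - v N) <= b N) ->
  b @ \oo --> (0 : R) -> tends_to v l -> tends_to u l.
Proof.
move=> uvb b0 /tends_toP vl; apply/tends_toP.
apply: (@squeeze_cvg0 _ (fun N => b N + modulus (v N - l))) => [N N1|].
  rewrite modulus_ge0 /= -[u N](subrK (v N)) -addrA.
  by rewrite (le_trans (le_modulusD _ _)) // lerD2r uvb.
by rewrite -(addr0 0); exact: cvgD.
Qed.

(** This is the N^(o(1)) of the estimates: decay of N^e x for every [e < 1] controls N x in this
    sense only. *)
Definition subpolynomial a :=
  forall e, 0 < e -> (fun N => N%:R `^ (- e) * a N) @ \oo --> (0 : R).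

Lemma subpolynomialD a b :
  subpolynomial a -> subpolynomial b -> subpolynomial (fun N => a N + b N).
Proof.
move=> sa sb e e0; under eq_fun do rewrite mulrDr.
by rewrite -(addr0 0); apply: cvgD; [apply: sa|apply: sb].
Qed.

Lemma subpolynomialM a b :
  subpolynomial a -> subpolynomial b -> subpolynomial (fun N => a N * b N).
Proof.
move=> sa sb e e0.
have e20 : 0 < e / 2 by rewrite divr_gt0.
under eq_fun => N.
  rewrite (_ : - e = - (e / 2) + - (e / 2)); last by rewrite -opprD -splitr.
  rewrite powRD; last by rewrite -opprD oppr_eq0 gt_eqF // addr_gt0.
  rewrite mulrACA; over.
by rewrite -(mulr0 0); apply: cvgM; [apply: sa|apply: sb].
Qed.

Lemma cvg_powRN e : 0 < e -> (fun N => N%:R `^ (- e)) @ \oo --> (0 : R).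
Proof.
move=> e0; apply/cvgr0Pnorm_le => d d0.
near=> N; rewrite ger0_norm ?powR_ge0 // powRN.
have N0 : (0 : R) < N%:R by rewrite ltr0n; near: N; exact: nbhs_infty_gt.
rewrite -[leRHS]invrK lef_pV2 ?posrE ?powR_gt0 ?invr_gt0 //.
have -> : d^-1 = (d^-1 `^ e^-1) `^ e.
  by rewrite -powRrM mulVf ?gt_eqF // powRr1 // invr_ge0 ltW.
apply: (ge0_ler_powR (ltW e0)); rewrite ?nnegrE ?powR_ge0 ?ler0n //.
by near: N; exact: nbhs_infty_ger.
Unshelve. all: by end_near. Qed.

Lemma subpolynomial_cvg a (l : R) : a @ \oo --> l -> subpolynomial a.
Proof.
by move=> al e e0; rewrite -(mul0r l); apply: cvgM (cvg_powRN e0) al.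
Qed.

Lemma subpolynomial_sum n (f : nat -> nat -> R) :
  (forall l, (l < n)%N -> subpolynomial (f l)) ->
  subpolynomial (fun N => \sum_(l < n) f l N).
Proof.
elim: n => [|n IHn] sf.
  by under eq_fun do rewrite big_ord0; apply: subpolynomial_cvg; exact: cvg_cst.
under eq_fun do rewrite big_ord_recr.
by apply: subpolynomialD; [apply: IHn => l ln; exact/sf/ltnW|exact: sf].
Qed.

Lemma subpolynomial_div a :
  subpolynomial a -> (fun N => N%:R^-1 * a N) @ \oo --> (0 : R).
Proof.
move=> /(_ 1 ltr01) sa.
by under eq_fun do rewrite -powR_inv1 //.
Qed.

End Modulus.

(** * The numerical recursion over runs *)

Section RunRecursion.

(* c l N, d l N and v l N stand for the expectations of the words x x^* x ...,
   x^* x x^* ... and y ^+ l, of length l, with x = b_{ij,N} for i < j and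
   y = b_{ii,N}. *)
Variables (R : realType) (c d v : nat -> nat -> R[i]).

Definition run_weight l N (i j : 'I_N) : R[i] :=
  if (i < j)%N then c l N else if (j < i)%N then d l N else v l N.

(** Stands for the expectation of [walks n i k p] for the matrix of size [N]. *)
Variable g : forall N, nat -> 'I_N -> 'I_N -> option ('I_N * 'I_N) -> R[i].
Hypothesis g0 : forall N (i k : 'I_N) p, (1 < N)%N -> g 0 i k p = (i == k)%:R.
Hypothesis gS : forall N n (i k : 'I_N) p, (1 < N)%N -> g n.+1 i k p =
  \sum_(l < n.+1) \sum_(j | Some (edge i j) != p) run_weight l.+1 i j *
    g (n - l) (if odd l.+1 then j else i) k (Some (edge i j)).

Hypothesis v_cvg : forall l, (0 < l)%N -> tends_to (v l) 0.
Hypothesis c_small : forall l, (0 < l)%N -> forall e : R, e < 1 ->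
  tends_to (fun N => (N%:R `^ e)%:C * c l N) 0.
Hypothesis d_small : forall l, (0 < l)%N -> forall e : R, e < 1 ->
  tends_to (fun N => (N%:R `^ e)%:C * d l N) 0.

(** * A priori bounds on walks *)

Let u l N : R := modulus (c l N) + modulus (d l N).
Let loop l N : R := modulus (v l N).
(** Dominates the sum over [j] of the moduli of the weights of runs of length [l] from a fixed
    vertex. *)
Let bound l N : R := loop l N + N%:R * u l N.

Let u_ge0 l N : 0 <= u l N.
Proof. by rewrite addr_ge0 ?modulus_ge0. Qed.

Let bound_ge0 l N : 0 <= bound l N.
Proof. by rewrite addr_ge0 ?modulus_ge0 ?mulr_ge0. Qed.

Let loop_cvg l : (0 < l)%N -> loop l @ \oo --> (0 : R).
Proof. by move=> /v_cvg/tends_to0P. Qed.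

(** The exponent [1 - e] is admissible in [c_small] and [d_small], and N^(1 - e) = N^(-e) N. *)
Let u_small l : (0 < l)%N -> subpolynomial (fun N => N%:R * u l N).
Proof.
move=> l0 e e0.
have e1 : 1 - e < 1 by rewrite gtrDl oppr_lt0.
have sum_cvg : (fun N => modulus ((N%:R `^ (1 - e))%:C * c l N) +
    modulus ((N%:R `^ (1 - e))%:C * d l N)) @ \oo --> (0 : R).
  rewrite -(addr0 0); apply: cvgD; apply/tends_to0P; first exact: c_small.
  exact: d_small.
apply: squeeze_cvg0 sum_cvg => N N1.
rewrite mulr_ge0 ?powR_ge0 ?mulr_ge0 //=.
have NE : N%:R `^ (1 - e) = N%:R `^ (- e) * N%:R :> R.
  rewrite addrC powRD ?powRr1 ?ler0n //.
  by apply/implyP => _; rewrite pnatr_eq0 gtn_eqF // ltnW.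
rewrite !modulusM !modulus_real !ger0_norm ?powR_ge0 //.
by rewrite NE -mulrDr mulrA.
Qed.

Let bound_small l : (0 < l)%N -> subpolynomial (bound l).
Proof.
move=> l0; apply: subpolynomialD; last exact: u_small.
exact: subpolynomial_cvg (loop_cvg l0).
Qed.

(** The matrix I + J / N, with J all ones: order 1 for closed walks and 1 / N for the others. *)
Let kernel N (i j : 'I_N) : R := (i == j)%:R + N%:R^-1.

Let kernel_ge0 N (i j : 'I_N) : 0 <= kernel i j.
Proof. by rewrite addr_ge0 ?invr_ge0. Qed.

Let weight_loop l N (i : 'I_N) : modulus (run_weight l i i) = loop l N.
Proof. by rewrite /run_weight ltnn. Qed.

Let weight_offdiag l N (i j : 'I_N) : i != j ->
  modulus (run_weight l i j) <= u l N.
Proof.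
rewrite -val_eqE /= /run_weight /u.
by case: ltngtP => // _ _; rewrite ?lerDl ?lerDr modulus_ge0.
Qed.

Let weight_bound l N (i j : 'I_N) : (1 < N)%N ->
  modulus (run_weight l i j) <= bound l N * kernel i j.
Proof.
move=> N1; have N0 : N%:R != 0 :> R by rewrite pnatr_eq0 gtn_eqF // ltnW.
rewrite /kernel; have [<-|ij] := eqVneq i j.
  rewrite weight_loop mulrDr mulr1 /bound -!addrA lerDl.
  by rewrite addr_ge0 ?mulr_ge0 ?invr_ge0 ?addr_ge0 ?modulus_ge0 ?mulr_ge0.
rewrite add0r mulrDl [_ * u _ _]mulrC mulfK //.
apply: (le_trans (weight_offdiag _ ij)).
by rewrite lerDr mulr_ge0 ?invr_ge0 ?modulus_ge0.
Qed.

(** After an odd run, (I + J / N)^2 = I + 3 J / N; after an even one, only the row sum 2 of [kernel]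
    appears. The constant 3 covers both. *)
Let sum_kernel N (i k : 'I_N) (b : bool) : (1 < N)%N ->
  \sum_j kernel i j * kernel (if b then j else i) k <= 3 * kernel i k.
Proof.
move=> N1; have N0 : N%:R != 0 :> R by rewrite pnatr_eq0 gtn_eqF // ltnW.
have sum1 (h : 'I_N -> R) : \sum_j (i == j)%:R * h j = h i.
  rewrite (bigD1 i) //= eqxx mul1r big1 ?addr0 // => j /negPf.
  by rewrite eq_sym => ->; rewrite mul0r.
have sumc (x : R) : \sum_(j < N) N%:R^-1 * x = x.
  by rewrite sumr_const card_ord -[LHS]mulr_natr mulrAC mulVf // mul1r.
have sum2 (h : 'I_N -> R) :
    \sum_j kernel i j * h j = h i + \sum_j N%:R^-1 * h j.
  by under eq_bigr do rewrite mulrDl; rewrite big_split sum1.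
rewrite sum2; case: b.
  have -> : \sum_j N%:R^-1 * kernel j k = N%:R^-1 + N%:R^-1 :> R.
    under eq_bigr do rewrite mulrDr.
    rewrite big_split sumc /=; congr (_ + _).
    rewrite -mulr_sumr (bigD1 k) //= eqxx big1 ?addr0 ?mulr1 // => j /negPf.
    by move=> ->.
  have : 0 <= (i == k)%:R :> R by [].
  by rewrite /kernel; lra.
by rewrite sumc; have := kernel_ge0 i k; lra.
Qed.

(* Each non-closed walk costs a factor N^-1, up to subpolynomial terms. *)
Let walk_bound n : exists s : nat -> R, [/\ subpolynomial s,
  forall N, 0 <= s N & forall N m (i k : 'I_N) p, (1 < N)%N -> (m <= n)%N ->
    modulus (g m i k p) <= s N * kernel i k].
Proof.
elim: n => [|n [s [s_small s_ge0 gs]]].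
  exists (fun=> 1); split=> // [|N m i k p N1].
    by apply: subpolynomial_cvg; exact: cvg_cst.
  rewrite leqn0 => /eqP ->; rewrite g0 // modulus_nat mul1r lerDl.
  by rewrite invr_ge0.
(* [s] serves the lengths up to [n]; length [n.+1] adds one term per length of the first run, with
   the 3 of [sum_kernel]. *)
exists (fun N => s N + \sum_(l < n.+1) 3 * bound l.+1 N * s N); split.
- apply: subpolynomialD => //.
  apply: (@subpolynomial_sum _ n.+1 (fun l N => 3 * bound l.+1 N * s N)) => l _.
  apply: subpolynomialM => //; apply: subpolynomialM; last exact: bound_small.
  by apply: subpolynomial_cvg; exact: cvg_cst.
- move=> N; rewrite addr_ge0 // sumr_ge0 // => l _.
  by rewrite !mulr_ge0.
move=> N m i k p N1; rewrite leq_eqVlt ltnS => /predU1P[->|mn]; last first.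
  rewrite mulrDl (le_trans (gs _ _ _ _ _ N1 mn)) // lerDl mulr_ge0 //.
  by rewrite sumr_ge0 // => l _; rewrite !mulr_ge0.
rewrite gS // mulrDl -[leLHS]add0r lerD ?mulr_ge0 //.
rewrite (le_trans (le_modulus_sum _ _ _)) // mulr_suml ler_sum // => l _.
rewrite (le_trans (le_modulus_sum _ _ _)) //.
have le_sum : \sum_(j | Some (edge i j) != p) modulus (run_weight l.+1 i j *
      g (n - l) (if odd l.+1 then j else i) k (Some (edge i j))) <=
    \sum_j bound l.+1 N * s N *
      (kernel i j * kernel (if odd l.+1 then j else i) k).
  rewrite big_mkcond ler_sum // => j _; case: ifP => _; last first.
    by rewrite !mulr_ge0.
  rewrite modulusM mulrACA ler_pM ?modulus_ge0 //; first exact: weight_bound.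
  by apply: gs; rewrite ?leq_subr.
rewrite (le_trans le_sum) // -mulr_sumr.
have -> x y z : 3 * x * y * z = x * y * (3 * z) :> R by ring.
by rewrite ler_wpM2l ?mulr_ge0 ?sum_kernel.
Qed.

(** * Asymptotics of closed walks *)

Variables (alpha beta : R) (alpha_gt0 : 0 < alpha) (beta_gt0 : 0 < beta).
Hypothesis c_var : tends_to (fun N => N%:R * c 2 N) alpha%:C.
Hypothesis d_var : tends_to (fun N => N%:R * d 2 N) beta%:C.
Hypothesis c_high : forall m, (1 < m)%N -> tends_to (fun N => N%:R * c m.*2 N) 0.
Hypothesis d_high : forall m, (1 < m)%N -> tends_to (fun N => N%:R * d m.*2 N) 0.

Definition variance_profile N (i : nat) : R :=
  alpha + (beta - alpha) * (i%:R / N%:R).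

Definition closed_walk_limit n N (i : nat) : R :=
  if odd n then 0 else variance_profile N i ^+ n./2.

Lemma variance_profile_bounds N i : (i <= N)%N ->
  0 <= variance_profile N i <= alpha + beta.
Proof.
move=> iN; have t0 : 0 <= i%:R / N%:R :> R by rewrite mulr_ge0 ?invr_ge0.
have t1 : i%:R / N%:R <= 1 :> R.
  case: N iN {t0} => [|N] iN; first by rewrite invr0 mulr0.
  by rewrite ler_pdivrMr ?ltr0n // mul1r ler_nat.
rewrite /variance_profile; set t := _ / _ in t0 t1 *.
have at0 : 0 <= alpha * (1 - t) by rewrite mulr_ge0 ?subr_ge0 // ltW.
have bt0 : 0 <= beta * t by rewrite mulr_ge0 // ltW.
have at1 : 0 <= alpha * t by rewrite mulr_ge0 // ltW.
have bt1 : 0 <= beta * (1 - t) by rewrite mulr_ge0 ?subr_ge0 // ltW.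
by apply/andP; split; lra.
Qed.

(** Uniformity in the vertex and in the forbidden edge lets these bounds pass through sums over
    [j]. *)
Let vanishing
    (f : forall N, 'I_N -> option ('I_N * 'I_N) -> R[i]) : Prop :=
  exists2 r : nat -> R, r @ \oo --> (0 : R) &
    forall N (i : 'I_N) p, (1 < N)%N -> modulus (f N i p) <= r N.

Let vanishing_sum n
    (f : nat -> forall N, 'I_N -> option ('I_N * 'I_N) -> R[i]) :
  (forall l, (l < n)%N -> vanishing (f l)) ->
  vanishing (fun N i p => \sum_(l < n) f l N i p).
Proof.
elim: n => [|n IHn] vf.
  exists (fun=> 0) => [|N i p _]; first exact: cvg_cst.
  by rewrite big_ord0 modulus0.
have [r r0 fr] := vf n (ltnSn n).
have [s s0 fs] := IHn (fun l ln => vf l (ltnW ln)).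
exists (fun N => s N + r N) => [|N i p N1].
  by rewrite -(addr0 0); exact: cvgD.
rewrite big_ord_recr /=.
by rewrite (le_trans (le_modulusD _ _)) // lerD ?fs ?fr.
Qed.

(** The loop [j = i] is kept apart: its weight merely tends to 0, but it occurs once instead of
    about N times. *)
Let weighted_sum l N (i : 'I_N) (P : pred 'I_N) (h : 'I_N -> R[i]) :
  modulus (\sum_(j | P j) run_weight l i j * h j) <=
  loop l N * modulus (h i) + u l N * \sum_(j | j != i) modulus (h j).
Proof.
rewrite (le_trans (le_modulus_sum _ _ _)) //.
have -> : loop l N * modulus (h i) + u l N * \sum_(j | j != i) modulus (h j) =
    \sum_j (if j == i then loop l N else u l N) * modulus (h j).
  rewrite [RHS](bigD1 i) //= eqxx; congr (_ + _); rewrite mulr_sumr.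
  by apply: eq_bigr => j /negPf ->.
rewrite big_mkcond ler_sum // => j _; case: ifP => _; last first.
  by case: ifP => _; rewrite mulr_ge0 ?modulus_ge0.
rewrite modulusM ler_wpM2r ?modulus_ge0 //.
case: eqP => [->|/eqP ji]; first by rewrite weight_loop.
by rewrite weight_offdiag 1?eq_sym.
Qed.

Let offdiag_sum_le N (i : 'I_N) (h : 'I_N -> R[i]) (x : R) : 0 <= x ->
  (forall j, j != i -> modulus (h j) <= x) ->
  \sum_(j | j != i) modulus (h j) <= N%:R * x.
Proof.
move=> x0 hx; rewrite big_mkcond (le_trans (y := \sum_(j < N) x)) //.
  by apply: ler_sum => j _; case: ifP => [/hx|_].
by rewrite sumr_const card_ord -[leLHS]mulr_natl.
Qed.

(** The share of [g n.+1 i i p] due to walks whose first run has length [l.+1]. *)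
Let run n l N (i : 'I_N) (p : option ('I_N * 'I_N)) : R[i] :=
  \sum_(j | Some (edge i j) != p) run_weight l.+1 i j *
    g (n - l) (if odd l.+1 then j else i) i (Some (edge i j)).

Let remainder n N (i : 'I_N) p : R[i] :=
  g n i i p - (closed_walk_limit n N i)%:C.

Let closed_walk_bounded m : vanishing (remainder m) ->
  exists2 q : nat -> R, exists l, q @ \oo --> (l : R) &
    forall N (i : 'I_N) p, (1 < N)%N -> modulus (g m i i p) <= q N.
Proof.
case=> r r0 gr; exists (fun N => r N + (alpha + beta) ^+ m./2).
  by eexists; apply: cvgD r0 (cvg_cst _).
move=> N i p N1; rewrite -[g _ _ _ _](subrK (closed_walk_limit m N i)%:C).
rewrite (le_trans (le_modulusD _ _)) // lerD ?gr //.
have /andP[p0 p1] := variance_profile_bounds (ltnW (ltn_ord i)).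
have ab0 := le_trans p0 p1.
rewrite modulus_real /closed_walk_limit; case: ifP => _.
  by rewrite normr0 exprn_ge0.
by rewrite normrX ger0_norm // lerXn2r ?nnegrE.
Qed.

(** The run has odd length [l.+1]. Off the loop there are at most N choices of [j], each of weight
    [u], and the way back costs [s / N] by [walk_bound]: in all N^-1 times a subpolynomial
    factor. *)
Let odd_run n l : ~~ odd l -> (l <= n)%N -> vanishing (remainder (n - l)) ->
  vanishing (run n l).
Proof.
move=> l_even ln /closed_walk_bounded[q [L qL] gq].
have [s [s_small s_ge0 gs]] := walk_bound n.
exists (fun N => loop l.+1 N * q N +
                 N%:R^-1 * ((N%:R * u l.+1 N) * s N)) => [|N i p N1].
  have -> : nbhs (0 : R) = nbhs (0 * L + 0) by rewrite mul0r addr0.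
  apply: cvgD.
    by apply: cvgM qL; exact: loop_cvg.
  by apply: subpolynomial_div; apply: subpolynomialM => //; exact: u_small.
have N0 : N%:R != 0 :> R by rewrite pnatr_eq0 gtn_eqF // ltnW.
rewrite (le_trans (weighted_sum _ _ _ _)) //= l_even.
rewrite lerD // ?ler_wpM2l ?modulus_ge0 ?gq //.
rewrite mulrA mulKf // ler_wpM2l //.
rewrite (le_trans (offdiag_sum_le (x := s N / N%:R) _ _)) ?mulr_ge0 ?invr_ge0 //.
  move=> j ji; rewrite (le_trans (gs _ _ _ _ _ N1 (leq_subr _ _))) //.
  by rewrite /kernel (negPf ji) add0r.
by rewrite mulrC divfK.
Qed.

Let u_high l : odd l -> (1 < l)%N ->
  (fun N => N%:R * u l.+1 N) @ \oo --> (0 : R).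
Proof.
move=> l_odd l1; have half_l : l.+1 = (l.+1)./2.*2.
  by rewrite -[LHS]odd_double_half /= l_odd.
have m1 : (1 < (l.+1)./2)%N by rewrite -ltn_double -half_l ltnS.
rewrite half_l /u; under eq_fun do rewrite mulrDr -modulus_nat -!modulusM.
rewrite -(addr0 0); apply: cvgD; apply/tends_to0P; first exact: c_high.
exact: d_high.
Qed.

(** The run returns to [i], so the rest is again a closed walk and is only bounded; the gain comes
    from [u_high]. *)
Let long_even_run n l : odd l -> (1 < l)%N -> vanishing (remainder (n - l)) ->
  vanishing (run n l).
Proof.
move=> l_odd l1 /closed_walk_bounded[q [L qL] gq].
exists (fun N => loop l.+1 N * q N + (N%:R * u l.+1 N) * q N) => [|N i p N1].
  have -> : nbhs (0 : R) = nbhs (0 * L + 0 * L) by rewrite mul0r addr0.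
  apply: cvgD.
    by apply: cvgM qL; exact: loop_cvg.
  by apply: cvgM qL; exact: u_high.
have q0 : 0 <= q N by rewrite (le_trans _ (gq N i None N1)) ?modulus_ge0.
rewrite (le_trans (weighted_sum _ _ _ _)) //= l_odd /=.
rewrite lerD // ?ler_wpM2l ?modulus_ge0 ?gq //.
rewrite [_ * u _ _]mulrC -mulrA ler_wpM2l // offdiag_sum_le // => j _.
exact: gq.
Qed.

Let sum_run_weight l N (i : 'I_N) : \sum_j run_weight l i j =
  (N%:R - 1 - i%:R) * c l N + i%:R * d l N + v l N.
Proof.
pose f j := if (i < j)%N then c l N else if (j < i)%N then d l N else v l N.
have -> : \sum_j run_weight l i j = \sum_(0 <= j < N) f j.
  by rewrite big_mkord.
rewrite (@big_cat_nat _ _ _ i) //= ?(ltnW (ltn_ord i)) // [X in _ + X]big_ltn //.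
rewrite (@eq_big_nat _ _ _ 0 i _ (fun=> d l N)); last first.
  by move=> j /= ji; rewrite /f ji ltnNge ltnW.
rewrite (@eq_big_nat _ _ _ i.+1 N _ (fun=> c l N)); last first.
  by move=> j /andP[ij _]; rewrite /f ij.
rewrite !sumr_const_nat /f ltnn subn0.
rewrite -[d l N *+ _]mulr_natl -[c l N *+ _]mulr_natl natrB // -natr1.
ring.
Qed.

(** By injectivity of [edge i], at most one [j] is excluded. *)
Let forbidden_edge l N (i : 'I_N) (p : option ('I_N * 'I_N)) :
  modulus (\sum_(j | Some (edge i j) == p) run_weight l i j) <=
  loop l N + u l N.
Proof.
case: (pickP (fun j => Some (edge i j) == p)) => [k /eqP kp|no_j]; last first.
  by rewrite big_pred0 // modulus0 addr_ge0 ?modulus_ge0.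
rewrite (big_pred1 k) => [|j]; last first.
  by rewrite -kp; apply/eqP/eqP => [[/edge_inj]|->].
have [<-|ik] := eqVneq i k; first by rewrite weight_loop lerDl.
by rewrite (le_trans (weight_offdiag _ ik)) // lerDr modulus_ge0.
Qed.

(** Errors in turn: N c against [alpha], N d against [beta], N - 1 - i larger indices counted as N -
    i, the loop, and the forbidden edge. *)
Let profile_deviation N : R :=
  modulus (N%:R * c 2 N - alpha%:C) + modulus (N%:R * d 2 N - beta%:C) +
  N%:R^-1 * alpha + loop 2 N + (loop 2 N + N%:R^-1 * (N%:R * u 2 N)).

Let sum_weight_deviation N (i : 'I_N) p : (1 < N)%N ->
  modulus (\sum_(j | Some (edge i j) != p) run_weight 2 i j -
           (variance_profile N i)%:C) <= profile_deviation N.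
Proof.
move=> N1; have N0 : N%:R != 0 :> R by rewrite pnatr_eq0 gtn_eqF // ltnW.
have NC0 : N%:R != 0 :> R[i] by rewrite pnatr_eq0 gtn_eqF // ltnW.
have i1 : modulus (i%:R / N%:R : R[i]) <= 1.
  rewrite modulusM modulusV !modulus_nat.
  by rewrite ler_pdivrMr ?mul1r ?ler_nat ?ltr0n ltnW.
have Ni1 : modulus ((N%:R - 1 - i%:R) / N%:R : R[i]) <= 1.
  have -> : N%:R - 1 - i%:R = (N - i.+1)%:R :> R[i].
    by rewrite natrB // -natr1; ring.
  rewrite modulusM modulusV !modulus_nat.
  by rewrite ler_pdivrMr ?mul1r ?ler_nat ?leq_subr ?ltr0n // ltnW.
have -> : \sum_(j | Some (edge i j) != p) run_weight 2 i j =
    \sum_j run_weight 2 i j - \sum_(j | Some (edge i j) == p) run_weight 2 i j.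
  rewrite [X in _ = X - _](bigID (fun j => Some (edge i j) == p)) /=.
  by rewrite addrAC subrr add0r.
rewrite sum_run_weight.
have -> : (variance_profile N i)%:C =
    alpha%:C + (beta%:C - alpha%:C) * (i%:R / N%:R) :> R[i].
  by rewrite /variance_profile rmorphD rmorphM rmorphB /= fmorph_div !rmorph_nat.
set e := \sum_(j | _) _.
have -> : (N%:R - 1 - i%:R) * c 2 N + i%:R * d 2 N + v 2 N - e -
    (alpha%:C + (beta%:C - alpha%:C) * (i%:R / N%:R)) =
    (N%:R - 1 - i%:R) / N%:R * (N%:R * c 2 N - alpha%:C) +
    i%:R / N%:R * (N%:R * d 2 N - beta%:C) + (- (N%:R^-1 * alpha%:C)) + v 2 N +
    (- e) by field.
have triangle x y a b : modulus x <= a -> modulus y <= b ->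
    modulus (x + y) <= a + b :> R.
  by move=> xa yb; rewrite (le_trans (le_modulusD _ _)) // lerD.
rewrite /profile_deviation.
do 4?[apply: (triangle _ _) => //].
- by rewrite modulusM ler_piMl ?modulus_ge0.
- by rewrite modulusM ler_piMl ?modulus_ge0.
- rewrite -sub0r modulusB subr0 modulusM modulusV.
  by rewrite modulus_nat modulus_real gtr0_norm.
- rewrite -sub0r modulusB subr0 mulKf //; exact: forbidden_edge.
Qed.

Let u2_cvg : exists L, (fun N => N%:R * u 2 N) @ \oo --> (L : R).
Proof.
eexists; rewrite /u; under eq_fun do rewrite mulrDr -modulus_nat -!modulusM.
by apply: cvgD; apply: tends_to_modulus; [exact: c_var|exact: d_var].
Qed.

Let profile_deviation_cvg : profile_deviation @ \oo --> (0 : R).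
Proof.
have -> : nbhs (0 : R) = nbhs ((0 + 0 + 0 + 0) + (0 + 0) : R) by rewrite !addr0.
apply: cvgD; [apply: cvgD; [apply: cvgD; [apply: cvgD|]|]|apply: cvgD].
- exact/tends_toP.
- exact/tends_toP.
- by apply: subpolynomial_div; apply: subpolynomial_cvg; exact: cvg_cst.
- exact: loop_cvg.
- exact: loop_cvg.
by apply: subpolynomial_div; exact: u_small.
Qed.

(** The error splits into the weights times the remainder of the rest of the walk, small since N u
    is bounded, and the limit of the rest times the deviation of the total weight from the
    profile. *)
Let short_even_run n : vanishing (remainder n) ->
  vanishing (fun N i p => run n.+1 1 i p - (closed_walk_limit n.+2 N i)%:C).
Proof.
move=> [r r0 gr]; have [L u2L] := u2_cvg.
pose K := (alpha + beta) ^+ n./2.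
exists (fun N => loop 2 N * r N + N%:R * u 2 N * r N + K * profile_deviation N).
  have -> : nbhs (0 : R) = nbhs (0 * 0 + L * 0 + K * 0).
    by rewrite !mulr0 !addr0.
  apply: cvgD; last exact: cvgM (cvg_cst _) profile_deviation_cvg.
  by apply: cvgD; apply: cvgM => //; exact: loop_cvg.
move=> N i p N1.
have r_ge0 : 0 <= r N by rewrite (le_trans _ (gr N i None N1)) ?modulus_ge0.
have /andP[p0 p1] := variance_profile_bounds (ltnW (ltn_ord i)).
have ab0 := le_trans p0 p1.
have -> : closed_walk_limit n.+2 N i =
    variance_profile N i * closed_walk_limit n N i.
  by rewrite /closed_walk_limit /= negbK; case: ifP; rewrite ?mulr0 // exprS.
have -> : run n.+1 1 i p -
      (variance_profile N i * closed_walk_limit n N i)%:C =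
    \sum_(j | Some (edge i j) != p) run_weight 2 i j *
        remainder n i (Some (edge i j)) +
    (closed_walk_limit n N i)%:C *
      (\sum_(j | Some (edge i j) != p) run_weight 2 i j -
       (variance_profile N i)%:C).
  rewrite mulrBr mulr_sumr addrA -big_split /= rmorphM /= [_%:C * _%:C]mulrC.
  congr (_ - _); rewrite /run subn1 /=; apply: eq_bigr => j _.
  by rewrite /remainder; ring.
rewrite (le_trans (le_modulusD _ _)) // lerD //.
  rewrite (le_trans (weighted_sum _ _ _ _)) // lerD //.
    by rewrite ler_wpM2l ?modulus_ge0 ?gr.
  rewrite [N%:R * _]mulrC -mulrA ler_wpM2l // offdiag_sum_le // => j _.
  exact: gr.
rewrite modulusM ler_pM ?modulus_ge0 ?sum_weight_deviation //.
rewrite modulus_real /closed_walk_limit; case: ifP => _.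
  by rewrite normr0 exprn_ge0.
by rewrite normrX ger0_norm // lerXn2r ?nnegrE.
Qed.

Lemma closed_walk_asymptotics n : exists2 r : nat -> R, r @ \oo --> (0 : R) &
  forall N (i : 'I_N) p, (1 < N)%N ->
    modulus (g n i i p - (closed_walk_limit n N i)%:C) <= r N.
Proof.
change (vanishing (remainder n)).
elim/ltn_ind: n => -[_|n IHn].
  exists (fun=> 0) => [|N i p N1]; first exact: cvg_cst.
  by rewrite /remainder g0 // eqxx subrr modulus0.
(* The whole limit is charged to [l = 1], a first run of length 2. *)
have [r r0 gr] : vanishing (fun N i p => \sum_(l < n.+1) (run n l i p -
    (if l == 1%N :> nat then closed_walk_limit n.+1 N i else 0)%:C)).
  apply: (vanishing_sum (f := fun l N i p => run n l i p -
    (if l == 1%N then closed_walk_limit n.+1 N i else 0)%:C)) => l ln.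
  have IHl : vanishing (remainder (n - l)) by apply: IHn; rewrite ltnS leq_subr.
  case: eqP => [l1|/eqP l1].
    rewrite l1 in ln IHl *; case: n ln IHl {IHn} => // n _.
    by rewrite subn1; exact: short_even_run.
  suff [r r0 gr] : vanishing (run n l).
    by exists r => // N i p N1; rewrite subr0 gr.
  have [l_odd|l_even] := boolP (odd l); last exact: odd_run.
  by apply: long_even_run => //; case: l l1 l_odd {ln IHl} => [|[]].
exists r => // N i p N1; rewrite (le_trans _ (gr N i p N1)) //.
rewrite /remainder gS // sumrB -rmorph_sum /=.
rewrite (_ : \sum_(l < n.+1) _ = closed_walk_limit n.+1 N i) //.
(* A walk of length one has no run of length 2, and its limit is 0. *)
case: n {IHn gr} => [|n]; first by rewrite big_ord1 /closed_walk_limit.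
rewrite (bigD1 (1 : 'I_n.+2)) //= big1 ?addr0 // => l l1.
by rewrite ifN.
Qed.

End RunRecursion.

(** * The limiting even moments *)

Section LimitMoment.
Variable R : realType.
Implicit Types alpha beta : R.

(** The integral over [0, 1] of (alpha + (beta - alpha) t)^m, with the quotient by [beta - alpha]
    expanded so that [alpha = beta] is allowed. *)
Definition limit_moment alpha beta m : R :=
  m.+1%:R^-1 * \sum_(k < m.+1) beta ^+ (m - k) * alpha ^+ k.

Lemma limit_moment_eq alpha m : limit_moment alpha alpha m = alpha ^+ m.
Proof.
rewrite /limit_moment (eq_bigr (fun=> alpha ^+ m)) => [|k _].
  by rewrite sumr_const card_ord -[X in _ * X]mulr_natl mulKf // pnatr_eq0.
by rewrite -exprD subnK // -ltnS.
Qed.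

(** These are the moments of the uniform law between [alpha] and [beta], whose variance (alpha -
    beta)^2 / 12 must vanish. *)
Lemma limit_moment_power alpha beta gamma :
  (forall m, limit_moment alpha beta m = gamma ^+ m) -> alpha = beta.
Proof.
move=> h; have := h 1%N; have := h 2%N.
rewrite /limit_moment !big_ord_recr !big_ord0 /= !subn0 subnn.
rewrite (_ : 2 - 1 = 1)%N // subnn !expr0 !expr1 => h2 h1.
have : (alpha - beta) ^+ 2 = 0.
  have <- : 12 * (3^-1 * (0 + beta ^+ 2 * 1 + beta * alpha + 1 * alpha ^+ 2) -
                  (2^-1 * (0 + beta * 1 + 1 * alpha)) ^+ 2) = (alpha - beta) ^+ 2.
    by field.
  by rewrite h1 h2 subrr mulr0.
by move/eqP; rewrite expf_eq0 subr_eq0 => /andP[_ /eqP].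
Qed.

End LimitMoment.

(** * Convergence of the averaged profile to its integral *)

Section ProfileAverage.
Variables (R : realType) (alpha beta : R).
Hypotheses (alpha_gt0 : 0 < alpha) (beta_gt0 : 0 < beta).

Lemma lipschitz_expr (K x y : R) n : 0 <= x <= K -> 0 <= y <= K ->
  `|x ^+ n - y ^+ n| <= `|x - y| * (n%:R * K ^+ n.-1).
Proof.
move=> /andP[x0 xK] /andP[y0 yK]; rewrite subrXX normrM ler_wpM2l //.
rewrite (le_trans (ler_norm_sum _ _ _)) //.
rewrite (le_trans (y := \sum_(i < n) K ^+ n.-1)) //; last first.
  by rewrite sumr_const card_ord -[leLHS]mulr_natl.
apply: ler_sum => i _; have K0 := le_trans x0 xK.
have -> : n.-1 = (n.-1 - i + i)%N.
  by rewrite subnK // -ltnS prednK // (leq_trans _ (ltn_ord i)).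
rewrite addnK exprD normrM !normrX !ger0_norm // ler_pM ?exprn_ge0 //.
  by rewrite lerXn2r ?nnegrE.
by rewrite lerXn2r ?nnegrE.
Qed.

(* The mean of x ^ m between alpha and beta, computed by telescoping the
   differences of x ^ m.+1. *)
Lemma profile_average m :
  (fun N => N%:R^-1 * \sum_(i < N) variance_profile alpha beta N i ^+ m)
    @ \oo --> limit_moment alpha beta m.
Proof.
(* The telescoping below cancels [beta - alpha]; when it is 0 the profile is constant. *)
have [ab|ab] := eqVneq alpha beta.
  rewrite -ab limit_moment_eq.
  apply: cvg_near_cst.
  near=> N; have N0 : N%:R != 0 :> R.
    by rewrite pnatr_eq0 -lt0n; near: N; exact: nbhs_infty_gt.
  rewrite (eq_bigr (fun=> alpha ^+ m)) => [|i _].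
    by rewrite sumr_const card_ord -[X in _ * X]mulr_natl mulKf.
  by rewrite /variance_profile subrr mul0r addr0.
pose x N i := variance_profile alpha beta N i.
pose K := alpha + beta.
(* [C / N] bounds the error at each [i]: the [k]-th term moves [m - k] factors from [x N i] to
   [x N i.+1], at distance [|beta - alpha| / N]. *)
pose C := m.+1%:R^-1 * \sum_(k < m.+1)
  K ^+ k * (`|beta - alpha| * ((m - k)%:R * K ^+ (m - k).-1)).
have xS N i : x N i.+1 - x N i = (beta - alpha) * N%:R^-1.
  by rewrite /x /variance_profile -natr1; ring.
(* Times the step [(beta - alpha) / N], each sum over [k] is an increment of x^(m + 1); these
   telescope from [alpha] at 0 to [beta] at [N]. *)
have limE N : (0 < N)%N -> limit_moment alpha beta m = N%:R^-1 * \sum_(i < N)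
    (m.+1%:R^-1 * \sum_(k < m.+1) x N i.+1 ^+ (m - k) * x N i ^+ k).
  move=> N0; have NR0 : N%:R != 0 :> R by rewrite pnatr_eq0 -lt0n.
  have ba0 : beta - alpha != 0 by rewrite subr_eq0 eq_sym.
  rewrite -mulr_sumr mulrCA; congr (_ * _); apply: (mulfI ba0).
  have /(_ beta alpha m.+1) /= <- := @subrXX R.
  rewrite mulrA mulr_sumr.
  under eq_bigr => i _.
    rewrite -(xS N i); have /(_ (x N i.+1) (x N i) m.+1) /= <- := @subrXX R.
    over.
  rewrite -(big_mkord xpredT (fun i => x N i.+1 ^+ m.+1 - x N i ^+ m.+1)).
  rewrite telescope_sumr // /x /variance_profile mul0r mulr0 addr0 divff //.
  by rewrite mulr1 [alpha + _]addrC subrK.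
apply/cvgrPdist_le => e e0.
have C_cvg : (fun N => N%:R^-1 * C) @ \oo --> (0 : R).
  by apply: subpolynomial_div; apply: subpolynomial_cvg; exact: cvg_cst.
near=> N.
have N0 : (0 < N)%N by near: N; exact: nbhs_infty_gt.
rewrite (le_trans (y := N%:R^-1 * C)) //; last first.
  near: N; move/cvgr0Pnorm_le: C_cvg => /(_ e e0).
  by apply: filterS => N; apply: le_trans; exact: ler_norm.
have x_bound i : (i <= N)%N -> 0 <= x N i <= K.
  exact: variance_profile_bounds.
have K0 : 0 <= K by rewrite addr_ge0 ?ltW.
rewrite (limE N N0) -mulrBr normrM ger0_norm ?invr_ge0 // ler_wpM2l ?invr_ge0 //.
rewrite -sumrB (le_trans (ler_norm_sum _ _ _)) //.
rewrite (le_trans (y := \sum_(i < N) N%:R^-1 * C)) //; last first.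
  rewrite sumr_const card_ord -[leLHS]mulr_natl mulrA mulfV ?mul1r //.
  by rewrite pnatr_eq0 -lt0n.
apply: ler_sum => i _.
(* Written as a mean of equal terms, to be compared with [limE] term by term. *)
have -> : x N i ^+ m = m.+1%:R^-1 * \sum_(k < m.+1) x N i ^+ m.
  by rewrite sumr_const card_ord -[X in _ * X]mulr_natl mulKf // pnatr_eq0.
rewrite -mulrBr normrM ger0_norm ?invr_ge0 // mulrCA ler_wpM2l ?invr_ge0 //.
rewrite -sumrB (le_trans (ler_norm_sum _ _ _)) // mulr_sumr ler_sum // => k _.
have km : (k <= m)%N by rewrite -ltnS.
have -> : x N i ^+ m = x N i ^+ (m - k) * x N i ^+ k by rewrite -exprD subnK.
have xi := x_bound i (ltnW (ltn_ord i)).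
rewrite -mulrBl normrM mulrC mulrCA ler_pM //.
  case/andP: xi => xi0 xiK.
  by rewrite normrX ger0_norm // lerXn2r ?nnegrE.
rewrite (le_trans (lipschitz_expr _ (x_bound i.+1 (ltn_ord i)) xi)) // xS.
by rewrite normrM [`|N%:R^-1|]ger0_norm ?invr_ge0 // -mulrA mulrCA.
Unshelve. all: by end_near. Qed.

End ProfileAverage.

(** * From the matrices to the recursion, and conclusion *)

Unset Implicit Arguments.

Theorem theorem5p1 (R : realType) (A : algType R[i])
    (star : A -> A) (star_adj : is_adjoint star)
    (phi : {scalar A}) (phi1 : phi 1 = 1)
    (B : forall N : nat, 'M[A]_N)
    (B_sa : forall N, (0 < N)%N -> mx_adjoint star (B N) = B N)
    (B_indep : forall N, (0 < N)%N ->
       boolean_independent_variables star phi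
         [set p : 'I_N * 'I_N | (p.1 <= p.2)%N] (fun p => B N p.1 p.2))
    (offdiag_id : forall N (i j k l : 'I_N), (i < j)%N -> (k < l)%N ->
       identically_distributed star phi (B N i j) (B N k l))
    (offdiag_word : forall i j : nat, (i < j)%N ->
       forall (e : R) (xi : seq bool), e < 1 -> (0 < size xi)%N ->
       tends_to (fun N => (N%:R `^ e)%:C
                          * phi (star_word star (entry (B N) i j) xi)) 0)
    (offdiag_high : forall i j : nat, (i < j)%N -> forall m : nat, (1 < m)%N ->
       tends_to (fun N => N%:R
         * phi ((entry (B N) i j * star (entry (B N) i j)) ^+ m)) 0 /\
       tends_to (fun N => N%:R
         * phi ((star (entry (B N) i j) * entry (B N) i j) ^+ m)) 0)
    (alpha beta : R) (alpha_gt0 : 0 < alpha) (beta_gt0 : 0 < beta)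
    (offdiag_var : forall i j : nat, (i < j)%N ->
       tends_to (fun N => N%:R
         * phi (entry (B N) i j * star (entry (B N) i j))) alpha%:C /\
       tends_to (fun N => N%:R
         * phi (star (entry (B N) i j) * entry (B N) i j)) beta%:C)
    (diag_sa : forall N (i : 'I_N), star (B N i i) = B N i i)
    (diag_id : forall N (i j : 'I_N),
       identically_distributed star phi (B N i i) (B N j j))
    (diag_moment : forall n i : nat, (0 < n)%N ->
       tends_to (fun N => phi (entry (B N) i i ^+ n)) 0) :
  [/\ asymptotic_distribution_exists phi B,
      forall n, odd n -> tends_to (moment phi B n) 0 &
      asymptotically_bernoulli phi B <-> alpha = beta].
Proof.
(* By identical distribution, the entries of indices (0, 1) and (0, 0) represent all others; both
   are genuine entries once [1 < N]. *)
pose c l N : R[i] :=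
  phi (star_word star (entry (B N) 0 1) (alternating_word false l)).
pose d l N : R[i] :=
  phi (star_word star (entry (B N) 0 1) (alternating_word true l)).
pose v l N : R[i] := phi (entry (B N) 0 0 ^+ l).
pose g N n (i k : 'I_N) p := phi (walks (B N) n i k p).
have entryE N (i j : 'I_N) : entry (B N) i j = B N i j.
  by rewrite /entry !valK.
have weightE N l (i j : 'I_N) : (1 < N)%N -> (0 < l)%N ->
    phi (back_and_forth (B N) l i j) = run_weight c d v l i j.
  case: N i j => [//|[//|N]] i j _ l0.
  pose o : 'I_N.+2 := Ordinal (isT : (1 < N.+2)%N).
  have entry01 : entry (B N.+2) 0 1 = B N.+2 ord0 o by rewrite -entryE.
  have entry00 : entry (B N.+2) 0 0 = B N.+2 ord0 ord0 by rewrite -entryE.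
  have [<-|ij] := eqVneq i j.
    rewrite back_and_forth_diag /run_weight ltnn /v entry00.
    rewrite -[l](size_nseq _ false) -!(@star_word_selfadjoint _ _ star) ?diag_sa //.
    by apply: diag_id; rewrite size_nseq.
  rewrite (back_and_forth_offdiag (B_sa _ _)) // /run_weight.
  rewrite (offdiag_id N.+2 _ _ ord0 o) ?size_traject //; last first.
    move: ij; rewrite -val_eqE /edge /=.
    by case: (ltngtP i j) => //= lt_ij _; exact: lt_ij.
  by move: ij; rewrite -val_eqE /= /c /d entry01; case: ltngtP.
have g0 N (i k : 'I_N) p : (1 < N)%N -> g N 0 i k p = (i == k)%:R.
  by move=> _; rewrite /g /=; case: (i == k); rewrite ?phi1 ?linear0.
have gS N n (i k : 'I_N) p : (1 < N)%N -> g N n.+1 i k p =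
    \sum_(l < n.+1) \sum_(j | Some (edge i j) != p) run_weight c d v l.+1 i j *
      g N (n - l)%N (if odd l.+1 then j else i) k (Some (edge i j)).
  move=> N1; have N0 := ltnW N1.
  rewrite /g (phi_walksS (B_sa N N0) phi1 (B_indep N N0)).
  apply: eq_bigr => l _; apply: eq_bigr => j _.
  by rewrite weightE.
have v_cvg l : (0 < l)%N -> tends_to (v l) 0 by move=> l0; exact: diag_moment.
have c_small l : (0 < l)%N -> forall e : R, e < 1 ->
    tends_to (fun N => (N%:R `^ e)%:C * c l N) 0.
  by move=> l0 e e1; apply: offdiag_word; rewrite ?size_traject.
have d_small l : (0 < l)%N -> forall e : R, e < 1 ->
    tends_to (fun N => (N%:R `^ e)%:C * d l N) 0.
  by move=> l0 e e1; apply: offdiag_word; rewrite ?size_traject.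
have cE m N : c m.*2 N =
    phi ((entry (B N) 0 1 * star (entry (B N) 0 1)) ^+ m).
  by rewrite /c star_word_even.
have dE m N : d m.*2 N =
    phi ((star (entry (B N) 0 1) * entry (B N) 0 1) ^+ m).
  by rewrite /d star_word_even.
have c_var : tends_to (fun N => N%:R * c 2 N) alpha%:C.
  under [X in tends_to X]eq_fun do rewrite (cE 1%N) expr1.
  by have [] := offdiag_var 0 1 isT.
have d_var : tends_to (fun N => N%:R * d 2 N) beta%:C.
  under [X in tends_to X]eq_fun do rewrite (dE 1%N) expr1.
  by have [] := offdiag_var 0 1 isT.
have c_high m : (1 < m)%N -> tends_to (fun N => N%:R * c m.*2 N) 0.
  move=> m1; under [X in tends_to X]eq_fun do rewrite cE.
  by have [] := offdiag_high 0 1 isT m m1.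
have d_high m : (1 < m)%N -> tends_to (fun N => N%:R * d m.*2 N) 0.
  move=> m1; under [X in tends_to X]eq_fun do rewrite dE.
  by have [] := offdiag_high 0 1 isT m m1.
pose L n : R := if odd n then 0 else limit_moment alpha beta n./2.
have moment_limit n : tends_to (moment phi B n) (L n)%:C.
  have [r r0 gr] := closed_walk_asymptotics g0 gS v_cvg c_small d_small
    alpha_gt0 beta_gt0 c_var d_var c_high d_high n.
  (* As [r] is uniform in [i], the normalized trace is within [r N] of this average. *)
  pose a N : R :=
    N%:R^-1 * \sum_(i < N) closed_walk_limit alpha beta n N i.
  have a_cvg : a @ \oo --> L n.
    rewrite /a /L /closed_walk_limit; case: ifP => _.
      by under eq_fun do rewrite big1 // mulr0; exact: cvg_cst.
    exact: profile_average.
  apply: (tends_to_squeeze _ r0 (tends_to_real a_cvg)) => N N1.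
  have N0 : (0 : R) < N%:R by rewrite ltr0n ltnW.
  rewrite /moment /phi_tr /a rmorphM fmorphV rmorph_nat rmorph_sum /= -mulrBr.
  rewrite -sumrB modulusM modulusV modulus_nat ler_pdivrMl //.
  rewrite (le_trans (le_modulus_sum _ _ _)) //.
  rewrite (le_trans (y := \sum_(i < N) r N)) //; last first.
    by rewrite sumr_const card_ord -[leLHS]mulr_natl.
  by apply: ler_sum => i _; rewrite expr_mx_walks; exact: gr.
split=> [n _|n n_odd|].
- by exists (L n)%:C.
- by have := moment_limit n; rewrite /L n_odd.
split=> [[gamma gamma_gt0 bernoulli]|ab].
  apply: (@limit_moment_power _ _ _ gamma) => m.
  have := tends_to_unique (moment_limit m.*2) (bernoulli m.*2).
  by rewrite /L odd_double doubleK => -[].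
exists alpha; first exact: alpha_gt0.
by move=> n; have := moment_limit n; rewrite /L -ab limit_moment_eq; case: odd.
Qed.
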